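(* There is an absolute constant $C>0$ such that for all integers $k\ge 2$ and all positive integers $n_1\ge n_2\ge\dots\ge n_k$, $$c^{\mathrm{PROP}}(n_1,\dots,n_k)\ \le\ C\sqrt{n_1}.$$
   Context: There is a finite set $G$ of items (goods) and $k$ groups of agents of sizes $n_1,\dots,n_k$. The $j$-th agent of group $i$ has a utility function $u^{(i,j)}$ on subsets of $G$ that is monotone and additive: $u^{(i,j)}(S)=\sum_{g\in S}u^{(i,j)}(g)$ for all $S\subseteq G$, with $u^{(i,j)}(g)\ge 0$ for all $g\in G$. An allocation $A=(A_1,\dots,A_k)$ is a partition of $G$ into $k$ (possibly empty) bundles, where $A_i$ is allocated to group $i$. For a nonnegative integer $c$, $A$ is proportional up to $c$ goods (PROP$c$) if for all $i\in\{1,\dots,k\}$ and $j\in\{1,\dots,n_i\}$ there is a set $B\subseteq G\setminus A_i$ with $|B|\le c$ such that $u^{(i,j)}(A_i)\ge u^{(i,j)}(G)/k-u^{(i,j)}(B)$. $c^{\mathrm{PROP}}(n_1,\dots,n_k)$ is the smallest $c$ such that, for every finite set $G$ of goods and every choice of monotone additive utilities of the agents, a PROP$c$ allocation exists. *)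

(* Defs.v *)
From mathcomp Require Import all_boot all_order all_algebra.
From mathcomp Require Import reals.

Set Implicit Arguments.
Unset Strict Implicit.
Unset Printing Implicit Defensive.

Import Order.TTheory GRing.Theory Num.Theory.
Local Open Scope ring_scope.

(* Utilities are functions on sets of goods; monotonicity follows from
   additivity and nonnegativity on single goods. *)
Definition monotone_additive (R : realType) (G : finType)
    (u : {set G} -> R) : Prop :=
  (forall S : {set G}, u S = \sum_(g in S) u [set g]) /\
  (forall g : G, 0 <= u [set g]).

(* [finset.partition] is not used because it forbids empty blocks. *)
Definition allocation (G : finType) (k : nat) (A : 'I_k -> {set G}) : Prop :=
  (forall i i' : 'I_k, i != i' -> [disjoint A i & A i']) /\
  \bigcup_(i < k) A i = [set: G].

(* Group [i] has [n i] agents and [u i j] is the utility of its [j]-th agent. *)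
Definition PROP (R : realType) (G : finType) (k : nat) (n : 'I_k -> nat)
    (u : forall i : 'I_k, 'I_(n i) -> {set G} -> R)
    (c : nat) (A : 'I_k -> {set G}) : Prop :=
  forall (i : 'I_k) (j : 'I_(n i)),
    exists B : {set G},
      [/\ B \subset [set: G] :\: A i, (#|B| <= c)%N &
          u i j (A i) >= u i j [set: G] / k%:R - u i j B].

Definition PROP_guaranteed (R : realType) (k : nat) (n : 'I_k -> nat)
    (c : nat) : Prop :=
  forall (G : finType) (u : forall i : 'I_k, 'I_(n i) -> {set G} -> R),
    (forall (i : 'I_k) (j : 'I_(n i)), monotone_additive (u i j)) ->
    exists A : 'I_k -> {set G}, allocation A /\ PROP u c A.

(* [is_cPROP R n c] says that c^PROP(n_1, ..., n_k) exists and equals [c]. *)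
Definition is_cPROP (R : realType) (k : nat) (n : 'I_k -> nat)
    (c : nat) : Prop :=
  PROP_guaranteed R n c /\
  (forall c' : nat, PROP_guaranteed R n c' -> (c <= c')%N).

(* Main.v *)
(* Rounding (Spencer's theorem, by the deterministic argument of Levy, Ramadas
   and Rothvoss).  Given at most m rows with entries in [-1, 1] and a point x of
   the cube [0, 1]^G, there is a vertex z with <a_i, z> <= <a_i, x> + O(sqrt m)
   for every row.  Linear algebra first leaves at most m fractional coordinates.
   A phase then takes n of them down to n / 16: one walks inside the cube while
   controlling the potential sum_i exp (lam <a_i, y - x>), in directions
   orthogonal to the rows of large weight, which turns the factor log m of the
   plain multiplicative weights bound into log (m / n).  The phase costs
   O((n m)^(1/4)), which halves from one phase to the next.

   Groups.  K groups with at most N agents each are split into two halves by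
   rounding the constant point K'/K against the K N agents.  The error
   O(sqrt (K N)) is shared by K' ~ K / 2 groups, so that each agent loses
   O(sqrt (N / K)); the sum over the halvings is dominated by its last terms and
   is O(sqrt N), whatever the number of groups.

   Goods.  For each agent, set aside the c goods T it values most and scale the
   other values into [0, 1] by their maximum w.  If A_i misses at most
   (c / 2) w <= u(T) / 2 of its share outside T, then B = T \ A_i repairs it. *)

Require Import Defs.
From mathcomp Require Import all_boot all_order all_algebra.
From mathcomp Require Import reals.
From mathcomp Require Import ring lra zify.
From mathcomp Require boolp sequences exp.

Set Implicit Arguments.
Unset Strict Implicit.
Unset Printing Implicit Defensive.

Import Order.TTheory GRing.Theory Num.Theory.
Local Open Scope ring_scope.

(** * Inner products, orthogonal directions and Bessel's inequality *)

Section Dot.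
Variables (R : realType) (G : finType).
Implicit Types (a u x : G -> R) (cs us : seq (G -> R)).

Definition dot a u : R := \sum_g a g * u g.

Definition orthogonal_to cs u := all (fun c => dot c u == 0) cs.

Lemma dotC a u : dot a u = dot u a.
Proof. by apply: eq_bigr => g _; rewrite mulrC. Qed.

Definition move x u (t : R) : G -> R := fun g => x g + t * u g.

Lemma dot_mover a x t u : dot a (move x u t) = dot a x + t * dot a u.
Proof.
rewrite /dot /move mulr_sumr -big_split /=; apply: eq_bigr => g _; ring.
Qed.

Lemma dot_movel a x t u : dot (move x u t) a = dot x a + t * dot u a.
Proof. by rewrite dotC dot_mover !(dotC a). Qed.

Lemma dot_sqr_ge0 a : 0 <= dot a a.
Proof. by apply: sumr_ge0 => g _; rewrite -expr2 sqr_ge0. Qed.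

(** The matrix whose columns are the members of [cs] has rank below [#|G|], so its left kernel has a
    nonzero row. *)
Lemma exists_orthogonal cs : (size cs < #|G|)%N ->
  exists u, (exists g, u g != 0) /\ orthogonal_to cs u.
Proof.
move=> ltcs.
pose M : 'M[R]_(#|G|, size cs) :=
  \matrix_(i, j) nth (fun=> 0) cs j (enum_val i).
have kM : kermx M != 0.
  rewrite -mxrank_eq0 mxrank_ker subn_eq0 -ltnNge.
  exact: leq_ltn_trans (rank_leq_col M) ltcs.
have /existsP[i] : [exists i, row i (kermx M) != 0].
  apply: contraNT kM; rewrite negb_exists => /forallP k0.
  by apply/eqP/row_matrixP => i; rewrite row0; apply/eqP; have := k0 i; rewrite negbK.
set v := row i _ => v0.
have vM : v *m M = 0 by rewrite /v -row_mul mulmx_ker row0.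
clearbody v.
exists (fun g => v 0 (enum_rank g)); split.
  have /existsP[j vj] : [exists j, v 0 j != 0].
    apply: contraNT v0; rewrite negb_exists => /forallP k0.
    by apply/eqP/rowP => j; rewrite [RHS]mxE; apply/eqP; have := k0 j; rewrite negbK.
  exists (enum_val j); rewrite enum_valK; exact: vj.
apply/(all_nthP (fun=> 0)) => j ltj.
have := congr1 (fun A : 'M_(1, _) => A 0 (Ordinal ltj)) vM.
rewrite !mxE => vj; apply/eqP; rewrite -[RHS]vj /dot.
rewrite (reindex (@enum_val G predT)) /=; last exact/onW_bij/enum_val_bij.
by apply: eq_bigr => l _; rewrite mxE enum_valK mulrC.
Qed.

Lemma exists_unit_orthogonal cs : (size cs < #|G|)%N ->
  exists u, dot u u = 1 /\ orthogonal_to cs u.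
Proof.
move=> /exists_orthogonal[u [[g ug] ou]].
have u2 : 0 < dot u u.
  rewrite lt_neqAle dot_sqr_ge0 andbT eq_sym psumr_neq0; last first.
    by move=> h _; rewrite -expr2 sqr_ge0.
  apply/hasP; exists g; rewrite ?mem_index_enum //= -expr2; by rewrite lt_neqAle sqr_ge0 eq_sym sqrf_eq0 ug.
have s0 : 0 < Num.sqrt (dot u u) by rewrite sqrtr_gt0.
have sc a : dot a (fun g => (Num.sqrt (dot u u))^-1 * u g)
            = (Num.sqrt (dot u u))^-1 * dot a u.
  by rewrite /dot mulr_sumr; apply: eq_bigr => h _; ring.
exists (fun g => (Num.sqrt (dot u u))^-1 * u g); split.
  rewrite sc dotC sc -{3}(sqr_sqrtr (ltW u2)); field; exact: lt0r_neq0.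
by apply: sub_all ou => c /eqP cu; rewrite sc cu mulr0.
Qed.

(* An orthonormal family, recorded through Bessel's inequality only. *)
Lemma exists_bessel_family r cs : (r + size cs <= #|G|)%N ->
  exists us, [/\ size us = r,
    all (fun u => dot u u == 1) us, all (orthogonal_to cs) us &
    forall a, \sum_(u <- us) dot a u ^+ 2 <= dot a a].
Proof.
elim: r cs => [|r IHr] cs lecs.
  by exists [::]; split=> // a; rewrite big_nil dot_sqr_ge0.
have [|u [u1 ou]] := @exists_unit_orthogonal cs.
  by apply: leq_trans lecs; rewrite ltnS leq_addl.
have [|us [sus us1 ous bus]] := IHr (u :: cs); first by rewrite /= addnS -addSn.
exists (u :: us); split=> /=; first by rewrite sus.
- by rewrite u1 eqxx us1.
- by rewrite ou; apply: sub_all ous => v /= /andP[].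
move=> a; rewrite big_cons.
(* Induction is applied to the component of [a] orthogonal to [u]: its products with [us] are those
   of [a], and its squared norm is smaller by [dot a u ^+ 2]. *)
have := bus (move a u (- dot a u)).
rewrite dot_mover !dot_movel (dotC u a) u1.
suff -> : \sum_(v <- us) dot (move a u (- dot a u)) v ^+ 2
          = \sum_(v <- us) dot a v ^+ 2 by move=> h; nra.
elim: us ous {sus us1 bus} => [|v us IH] /=; first by rewrite !big_nil.
by move=> /andP[/andP[/eqP uv _]] /IH; rewrite !big_cons dot_movel uv mulr0 addr0 => ->.
Qed.

(** By Bessel, the quadratic form summed over [r] orthonormal directions is at most the right-hand
    side; a direction with the least value is at most the average. *)
Lemma exists_small_direction (I : finType) (w : I -> R) (b : I -> G -> R)
    r cs : (0 < r)%N -> (r + size cs <= #|G|)%N -> (forall i, 0 <= w i) ->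
  exists u, [/\ dot u u = 1, orthogonal_to cs u &
    r%:R * (\sum_i w i * dot (b i) u ^+ 2) <= \sum_i w i * dot (b i) (b i)].
Proof.
move=> r0 lecs w0.
have [us [sus us1 ous bus]] := exists_bessel_family lecs.
pose q u := \sum_i w i * dot (b i) u ^+ 2.
have : \sum_(u <- us) q u <= \sum_i w i * dot (b i) (b i).
  rewrite exchange_big /=; apply: ler_sum => i _.
  by rewrite -mulr_sumr ler_wpM2l.
set B := \sum_i _; move=> leB.
have : exists u, [/\ dot u u = 1, orthogonal_to cs u &
    (size us)%:R * q u <= \sum_(u <- us) q u].
  rewrite -sus in r0; elim: us us1 ous r0 {sus bus leB} => // u us IH /=.
  move=> /andP[/eqP u1 us1] /andP[ou ous] _; rewrite big_cons.
  case: (posnP (size us)) => [/size0nil->|us0].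
    by exists u; split=> //=; rewrite big_nil addr0 mul1r.
  have [v [v1 ov qv]] := IH us1 ous us0.
  have [quv|qvu] := leP (q u) (q v).
    exists u; split=> //; rewrite -addn1 natrD mulrDl mul1r addrC lerD2l.
    by apply: le_trans qv; rewrite ler_wpM2l.
  by exists v; split=> //; rewrite -addn1 natrD mulrDl mul1r addrC lerD // ltW.
by rewrite sus => -[u [u1 ou qu]]; exists u; split=> //; apply: le_trans leB.
Qed.

End Dot.

Notation expR := sequences.expR.

(** * Walking inside the cube *)

Section Box.
Variables (R : realType) (G : finType).
Implicit Types (u x y : G -> R).

Definition in_box x := forall g, 0 <= x g <= 1.

Definition alive x : {set G} := [set g | (x g != 0) && (x g != 1)].

Lemma alive_bounds x g : in_box x -> g \in alive x -> 0 < x g < 1.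
Proof.
move=> bx; rewrite inE => /andP[x0 x1]; have /andP[le0 le1] := bx g.
by rewrite !lt_neqAle eq_sym x0 le0 x1.
Qed.

Lemma move_in_box y u (d : R) : 0 < d -> in_box y ->
  (forall g, g \notin alive y -> u g = 0) ->
  exists t : R, [/\ 0 < t <= d, in_box (move y u t),
    alive (move y u t) \subset alive y &
    t = d \/ (#|alive (move y u t)| < #|alive y|)%N].
Proof.
move=> d0 yb u0.
(* The time at which coordinate [g] reaches 0 or 1, with default [d] if it stands still; the walk
   stops at the least of these times or at [d]. *)
pose tau g := if 0 < u g then (1 - y g) / u g
              else if u g < 0 then - y g / u g else d.
have tau_gt0 g : 0 < tau g.
  rewrite /tau; case: (ltrgt0P (u g)) => // ug.
    have [/(alive_bounds yb)/andP[_ y1]|/u0 ug0] := boolP (g \in alive y).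
      by rewrite divr_gt0 // subr_gt0.
    by rewrite ug0 ltxx in ug.
  have [/(alive_bounds yb)/andP[y0 _]|/u0 ug0] := boolP (g \in alive y).
    by rewrite -mulrNN opprK -invrN divr_gt0 // oppr_gt0.
  by rewrite ug0 ltxx in ug.
have stay (t : R) : 0 < t -> (forall g, t <= tau g) -> in_box (move y u t).
  move=> t0 tt g; rewrite /move; have /andP[y0 y1] := yb g; have := tt g; rewrite /tau.
  case: (ltrgt0P (u g)) => ug.
  - rewrite ler_pdivlMr // => h; have : 0 < t * u g by rewrite mulr_gt0.
    move=> ?; lra.
  - rewrite ler_ndivlMr // => h; have : t * u g < 0 by rewrite pmulr_rlt0.
    move=> ?; lra.
  - by move=> _; rewrite ug mulr0 addr0 y0.
have sub t : alive (move y u t) \subset alive y.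
  apply/subsetP => g; apply: contraTT => ga; rewrite inE /move u0 // mulr0 addr0.
  by rewrite inE in ga.
have [/forallP tt|] := boolP [forall g, d <= tau g].
  by exists d; split; rewrite ?d0 ?lexx //; [apply: stay | left].
rewrite negb_forall => /existsP[g0]; rewrite -ltNge => lt0.
have [g1 _ min1] := @arg_minP _ R G g0 predT tau isT.
have lt1 : tau g1 < d by apply: le_lt_trans lt0; apply: min1.
exists (tau g1); split; rewrite ?tau_gt0 ?ltW //.
  by apply: stay => // g; apply: min1.
right; apply: proper_card; rewrite properE sub /=.
apply/subsetPn; exists g1.
  apply: contraT => /u0 ug; move: lt1.
  by rewrite /tau ug ltxx ltxx.
rewrite inE negb_and !negbK /move; move: lt1; rewrite /tau.
case: (ltrgt0P (u g1)) => ug lt1.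
- by apply/orP; right; apply/eqP; field; exact: lt0r_neq0.
- by apply/orP; left; apply/eqP; field; exact: ltr0_neq0.
- by rewrite ltxx in lt1.
Qed.

End Box.

(** * Elementary bounds on the exponential *)

Section Exp.
Variable R : realType.
Implicit Types z : R.

Lemma expR_le_inv z : z < 1 -> expR z <= (1 - z)^-1.
Proof.
move=> z1; rewrite -[z in expR z]opprK exp.expRN lef_pV2 ?posrE ?subr_gt0 //.
  exact: exp.expR_ge1Dx.
exact: exp.expR_gt0.
Qed.

Lemma expR_le2 z : z <= 1 / 2 -> expR z <= 2.
Proof.
move=> z2; apply: le_trans (expR_le_inv _) _; first by lra.
rewrite -[leRHS]invrK lef_pV2 ?posrE ?invr_gt0; lra.
Qed.

Lemma expR_le_quadratic z : `|z| <= 1 / 2 -> expR z <= 1 + z + 2 * z ^+ 2.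
Proof.
rewrite ler_norml => /andP[z1 z2]; apply: le_trans (expR_le_inv _) _; first by lra.
rewrite -[leLHS]mul1r ler_pdivrMr; last by lra.
nra.
Qed.

(** Quadratic growth is what later beats a ratio [m / n] that equals a square. *)
Lemma expR_ge_sqr z : 0 <= z -> (1 + z / 2) ^+ 2 <= expR z.
Proof.
move=> z0; have {2}-> : z = 2%:R * (z / 2) by field.
rewrite exp.expRM_natl; apply: lerXn2r; rewrite ?nnegrE ?exp.expR_ge0 //.
  lra.
exact: exp.expR_ge1Dx.
Qed.

End Exp.

(** * One phase: the potential-guided walk *)

Section Phase.
Variables (R : realType) (G I : finType) (a : I -> G -> R).
Implicit Types (u x y : G -> R) (i : I) (g : G).
Hypothesis a_le1 : forall i g, `|a i g| <= 1.

Lemma dot_mask i y u : (forall g, g \notin alive y -> u g = 0) ->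
  dot (a i) u = dot (fun g => if g \in alive y then a i g else 0) u.
Proof.
move=> u0; apply: eq_bigr => g _; case: ifPn => // /u0 ->.
by rewrite mulr0 mul0r.
Qed.

Lemma dot_mask_le i y (b := fun g => if g \in alive y then a i g else 0) :
  dot b b <= #|alive y|%:R.
Proof.
rewrite /dot -sum1_card natr_sum [leRHS]big_mkcond /=; apply: ler_sum => g _.
rewrite /b; case: ifP => _; last by rewrite mulr0.
by rewrite -expr2 -real_normK ?num_real // expr_le1 ?normr_ge0.
Qed.

Lemma dot_unit_le i u : dot u u = 1 -> `|dot (a i) u| <= #|G|%:R.
Proof.
move=> u1; apply: le_trans (ler_norm_sum _ _ _) _.
rewrite -sum1_card natr_sum; apply: ler_sum => g _.
have : u g ^+ 2 <= 1.
  rewrite -u1 /dot (bigD1 g) //= -expr2 lerDl.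
  by apply: sumr_ge0 => h _; rewrite -expr2 sqr_ge0.
rewrite -real_normK ?num_real // expr_le1 ?normr_ge0 // normrM => ug.
by rewrite -[leRHS]mulr1 ler_pM ?normr_ge0.
Qed.

(** Turns the freezing of a coordinate into an orthogonality constraint. *)
Lemma dot_indicator g u : dot (fun h => (h == g)%:R) u = u g.
Proof.
rewrite /dot (bigD1 g) //= eqxx mul1r big1 ?addr0 // => h /negPf ->.
by rewrite mul0r.
Qed.

(* At most [n / 64] rows are heavy.  Orthogonality to [y] makes the energy
   [dot y y] grow by exactly the square of the step. *)
Lemma exists_step_direction (w : I -> R) (n : nat) y :
  (256 <= n)%N -> (n < 16 * #|alive y|)%N -> (forall i, 0 < w i) ->
  exists u, [/\ dot u u = 1, forall g, g \notin alive y -> u g = 0,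
    dot y u = 0, \sum_i w i * dot (a i) u = 0 &
    (\sum_i w i * dot (a i) u ^+ 2 <= 2 * \sum_i w i) /\
    (forall i, 64 * \sum_i w i < n%:R * w i -> dot (a i) u = 0)].
Proof.
move=> n256 ny w0; set Phi := \sum_i w i.
pose T := [set i | 64 * Phi < n%:R * w i].
(* Markov's inequality for the weights. *)
have cT : (64 * #|T| <= n)%N.
  have [->|[i0 _]] := set_0Vmem T; first by rewrite cards0 muln0.
  have Phi0 : 0 < Phi.
    rewrite /Phi (bigD1 i0) //= ltr_pwDl // sumr_ge0 // => j _; exact/ltW.
  suff : (64 * #|T|)%:R * Phi <= n%:R * Phi by rewrite ler_pM2r // ler_nat.
  apply: le_trans (_ : \sum_(i in T) n%:R * w i <= _).
    rewrite mulnC natrM -mulrA -sum1_card natr_sum mulr_suml.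
    by apply: ler_sum => i; rewrite inE mul1r => /ltW.
  rewrite -mulr_sumr ler_wpM2l // /Phi [leRHS](bigID (mem T)) /= lerDl.
  by apply: sumr_ge0 => j _; exact/ltW.
pose b i g := if g \in alive y then a i g else 0.
pose cs := [seq (fun h => (h == g)%:R : R) | g <- enum (~: alive y)] ++
  [seq a i | i <- enum T] ++ [:: fun g => \sum_i w i * a i g; y].
have Gy : (#|alive y| + #|~: alive y| = #|G|)%N by rewrite cardsC.
have [||//|u [u1]] := @exists_small_direction R G I w b (#|alive y| - #|T| - 2) cs.
- by lia.
- rewrite !size_cat !size_map -!cardE /=; move: Gy cT ny n256.
  set A := #|alive y|; set D := #|~: _|; set t := #|T|; set N := #|G|; lia.
- by move=> i; apply/ltW.
rewrite /cs /orthogonal_to !all_cat !all_map /= andbT.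
move=> /and3P[/allP ud /allP uT /andP[/eqP ug /eqP uy]] ub.
have u0 g : g \notin alive y -> u g = 0.
  move=> gy; apply/eqP; rewrite -(dot_indicator g u); apply: ud.
  by rewrite mem_enum inE.
exists u; split=> //; last split.
- rewrite -[RHS]ug /dot; under eq_bigr do rewrite mulr_sumr.
  rewrite exchange_big /=; apply: eq_bigr => g _; rewrite mulr_suml.
  by apply: eq_bigr => i _; rewrite mulrA.
- have Phi0 : 0 <= Phi by apply: sumr_ge0 => i _; exact/ltW.
  move: ub; under eq_bigr do rewrite -dot_mask //.
  set q := \sum_i _ => ub.
  have {}ub : (#|alive y| - #|T| - 2)%:R * q <= #|alive y|%:R * Phi.
    apply: le_trans ub _; rewrite mulr_sumr; apply: ler_sum => i _.
    by rewrite mulrC ler_wpM2r ?dot_mask_le // ltW.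
  have q0 : 0 <= q by apply: sumr_ge0 => i _; rewrite mulr_ge0 ?sqr_ge0 // ltW.
  have r0 : (0 < #|alive y| - #|T| - 2)%N by lia.
  (* [#|T| <= n / 64] is below a quarter of [#|alive y|], and [#|alive y| > 16] since [n >= 256], so
     at least half of the dimensions remain; hence the factor 2. *)
  have : #|alive y|%:R <= 2 * (#|alive y| - #|T| - 2)%:R :> R.
    by rewrite -natrM ler_nat; lia.
  move: r0; rewrite -(ltr_nat R); set r := (_ - 2)%:R => r0 ry.
  rewrite -(ler_pM2l r0); apply: le_trans ub _.
  by rewrite mulrA [r * 2]mulrC ler_wpM2r.
- by move=> i Ti; apply/eqP/uT; rewrite mem_enum inE.
Qed.

Definition weight (lam : R) x y i : R := expR (lam * (dot (a i) y - dot (a i) x)).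

(* The last clause survives a step because heavy rows do not move and light rows
   at most double, starting from [64 * m / n] times the exponential. *)
Definition phase_inv (lam : R) (n m : nat) x y :=
  [/\ in_box y, alive y \subset alive x,
    forall g, g \notin alive x -> y g = x g,
    \sum_i weight lam x y i
      <= m%:R * expR (4 * lam ^+ 2 * (dot y y - dot x x)) &
    forall i, n%:R * weight lam x y i
      <= 128 * m%:R * expR (4 * lam ^+ 2 * n%:R)].

Lemma weight_gt0 lam x y i : 0 < weight lam x y i.
Proof. exact: exp.expR_gt0. Qed.

Lemma phase_inv_energy lam n m x y : (#|alive x| <= n)%N ->
  phase_inv lam n m x y -> dot y y - dot x x <= n%:R.
Proof.
move=> xn [yb _ yx _ _]; apply: (@le_trans _ _ #|alive x|%:R); last by rewrite ler_nat.
rewrite /dot -sumrB -sum1_card natr_sum [leRHS]big_mkcond /=.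
apply: ler_sum => g _; case: ifPn => [_|/yx ->]; last by rewrite subrr.
have /andP[y0 y1] := yb g; nra.
Qed.

Lemma weight_move lam x y u t i :
  weight lam x (move y u t) i = weight lam x y i * expR (lam * t * dot (a i) u).
Proof. by rewrite /weight -exp.expRD dot_mover; congr expR; ring. Qed.

(** The length [d] keeps each exponent's change within 1/2, where the quadratic bound on [expR]
    holds. Its linear term cancels by the choice of [u], and its quadratic term multiplies the
    potential by at most [1 + 4 * lam ^+ 2 * t ^+ 2], which the energy gain [t ^+ 2] pays for. *)
Lemma phase_step lam n m x y : 0 < lam -> (256 <= n)%N ->
  (#|alive x| <= n)%N -> (n < 16 * #|alive y|)%N -> phase_inv lam n m x y ->
  let d := (2 * lam * (#|G|%:R + 1))^-1 in
  exists z, [/\ phase_inv lam n m x z,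
    dot y y <= dot z z, (#|alive z| <= #|alive y|)%N &
    dot z z = dot y y + d ^+ 2 \/ (#|alive z| < #|alive y|)%N].
Proof.
move=> lam0 n256 xn ny inv d.
have [yb yx yfix Phiy wy] := inv.
set w := weight lam x y in Phiy wy.
have w0 i : 0 < w i by exact: weight_gt0.
have [u [u1 u0 yu wu [qu Tu]]] := exists_step_direction n256 ny w0.
have d0 : 0 < d by rewrite invr_gt0 !mulr_gt0 // ltr_wpDl.
have [t [/andP[t0 td] zb za zd]] := move_in_box d0 yb u0.
set z := move y u t in zb za zd *.
have zz : dot z z = dot y y + t ^+ 2.
  by rewrite /z dot_mover !dot_movel (dotC u y) yu u1; ring.
have small i : `|lam * t * dot (a i) u| <= 1 / 2.
  rewrite !normrM (ger0_norm (ltW lam0)) (ger0_norm (ltW t0)).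
  apply: (@le_trans _ _ (lam * d * #|G|%:R)).
    apply: ler_pM => //; last exact: dot_unit_le.
      by apply/mulr_ge0; apply/ltW.
    by rewrite ler_wpM2l // ltW.
  have G0 : 0 <= #|G|%:R :> R by [].
  have -> : lam * d * #|G|%:R = #|G|%:R / (#|G|%:R + 1) / 2.
    by rewrite /d; field; rewrite ?lt0r_neq0 // ltr_wpDl.
  rewrite ler_pM2r; last by rewrite invr_gt0.
  by rewrite ler_pdivrMr ?ltr_wpDl // mul1r lerDl.
exists z; split.
- split=> //.
  + exact: subset_trans za yx.
  + move=> g gx; rewrite /z /move u0 ?mulr0 ?addr0 ?yfix //.
    by rewrite (contraNN _ gx) //; apply/subsetP.
  + apply: (@le_trans _ _ ((1 + 4 * lam ^+ 2 * t ^+ 2) * \sum_i w i)).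
      apply: (@le_trans _ _ (\sum_i w i * (1 + lam * t * dot (a i) u
                 + 2 * (lam * t * dot (a i) u) ^+ 2))).
        by apply: ler_sum => i _; rewrite weight_move ler_wpM2l ?expR_le_quadratic // ltW.
      have -> : \sum_i w i * (1 + lam * t * dot (a i) u
                 + 2 * (lam * t * dot (a i) u) ^+ 2)
        = \sum_i w i + lam * t * (\sum_i w i * dot (a i) u)
          + 2 * (lam * t) ^+ 2 * (\sum_i w i * dot (a i) u ^+ 2).
        by rewrite !mulr_sumr -!big_split /=; apply: eq_bigr => i _; ring.
      rewrite wu mulr0 addr0 [leRHS]mulrDl mul1r lerD2l.
      have -> : 4 * lam ^+ 2 * t ^+ 2 * \sum_i w i
        = 2 * (lam * t) ^+ 2 * (2 * \sum_i w i) by ring.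
      by rewrite ler_wpM2l // mulr_ge0 // sqr_ge0.
    have -> : expR (4 * lam ^+ 2 * (dot z z - dot x x))
      = expR (4 * lam ^+ 2 * t ^+ 2) * expR (4 * lam ^+ 2 * (dot y y - dot x x)).
      by rewrite -exp.expRD zz; congr expR; ring.
    rewrite [leRHS]mulrCA.
    apply: ler_pM.
    * have := mulr_ge0 (sqr_ge0 lam) (sqr_ge0 t); lra.
    * by apply: sumr_ge0 => i _; exact/ltW.
    * exact: exp.expR_ge1Dx.
    * exact: Phiy.
  + move=> i; rewrite weight_move.
    have [/Tu ->|light] := ltP (64 * \sum_i w i) (n%:R * w i).
      by rewrite mulr0 exp.expR0 mulr1 wy.
    have e2 : expR (lam * t * dot (a i) u) <= 2.
      by apply: expR_le2; apply: le_trans (ler_norm _) (small i).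
    rewrite mulrA; apply: (@le_trans _ _ (64 * (\sum_i w i) * 2)).
      by rewrite ler_pM ?mulr_ge0 ?exp.expR_ge0 // ltW.
    have -> : 64 * (\sum_i w i) * 2 = 128 * \sum_i w i by ring.
    rewrite -mulrA ler_wpM2l //; apply: le_trans Phiy _.
    rewrite ler_wpM2l // exp.ler_expR ler_wpM2l ?(phase_inv_energy xn inv) //.
    by rewrite mulr_ge0 // sqr_ge0.
- by rewrite zz lerDl sqr_ge0.
- exact: subset_leq_card.
- by case: zd => [<-|zd]; [left|right].
Qed.

Lemma exists_phase lam n m x : 0 < lam -> (256 <= n <= m)%N ->
  (#|alive x| <= n)%N -> (#|I| <= m)%N -> in_box x ->
  exists y, [/\ in_box y, (16 * #|alive y| <= n)%N &
    forall i, n%:R * expR (lam * (dot (a i) y - dot (a i) x))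
      <= 128 * m%:R * expR (4 * lam ^+ 2 * n%:R)].
Proof.
move=> lam0 /andP[n256 nm] xn Im xb.
pose d := (2 * lam * (#|G|%:R + 1))^-1.
have d0 : 0 < d ^+ 2 by rewrite exprn_gt0 // invr_gt0 !mulr_gt0 // ltr_wpDl.
suff [y yn inv] : exists2 y, (16 * #|alive y| <= n)%N & phase_inv lam n m x y.
  by exists y; case: inv.
(* Every step freezes a coordinate or gains energy [d ^+ 2]; both are bounded. *)
have walk k : (exists2 y, (16 * #|alive y| <= n)%N & phase_inv lam n m x y) \/
    exists2 y, phase_inv lam n m x y &
      k%:R + #|alive y|%:R <= #|alive x|%:R + (dot y y - dot x x) / d ^+ 2.
  elim: k => [|k [?|[y inv ky]]]; [right; exists x| by left |].
  - split=> //.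
    + rewrite subrr mulr0 exp.expR0 mulr1.
      rewrite (eq_bigr (fun=> 1)) ?sumr_const ?ler_nat // => i _.
      by rewrite /weight subrr mulr0 exp.expR0.
    + move=> i; rewrite /weight subrr mulr0 exp.expR0.
      have e1 : 1 <= expR (4 * lam ^+ 2 * n%:R).
        apply: le_trans (exp.expR_ge1Dx _).
        have := mulr_ge0 (sqr_ge0 lam) (ler0n R n); lra.
      have nm' : n%:R <= m%:R :> R by rewrite ler_nat.
      have n0 : 0 <= n%:R :> R by [].
      nra.
  - by rewrite subrr mul0r addr0 add0r.
  have [yn|yn] := leqP (16 * #|alive y|) n; first by left; exists y.
  right; have [z [invz yz zy zd]] := phase_step lam0 n256 xn yn inv.
  exists z => //; rewrite -addn1 natrD.
  have {}zy : #|alive z|%:R <= #|alive y|%:R :> R by rewrite ler_nat.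
  case: zd => [zz|zlt].
    have -> : (dot z z - dot x x) / d ^+ 2 = (dot y y - dot x x) / d ^+ 2 + 1.
      rewrite zz -/d; have := lt0r_neq0 d0; move: (d ^+ 2) => e e0; field.
      exact: e0.
    lra.
  have {}zlt : #|alive z|%:R + 1 <= #|alive y|%:R :> R by rewrite natr1 ler_nat.
  have : (dot y y - dot x x) / d ^+ 2 <= (dot z z - dot x x) / d ^+ 2.
    by rewrite ler_pM2r ?invr_gt0 // lerD2r.
  lra.
have [//|[y inv]] := walk (Num.bound (#|alive x|%:R + n%:R / d ^+ 2)).
have B0 : 0 <= #|alive x|%:R + n%:R / d ^+ 2.
  by rewrite addr_ge0 // divr_ge0 // ltW.
have := archi_boundP B0; set N := _%:R => lt le.
have : (dot y y - dot x x) / d ^+ 2 <= n%:R / d ^+ 2.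
  by rewrite ler_pM2r ?invr_gt0 // (phase_inv_energy xn inv).
have : 0 <= #|alive y|%:R :> R by [].
lra.
Qed.

End Phase.

(** * Rounding a point of the cube to a vertex *)

Section Rounding.
Variables (R : realType) (G I : finType) (a : I -> G -> R).
Implicit Types (u x y z : G -> R) (i : I) (g : G).
Hypothesis a_le1 : forall i g, `|a i g| <= 1.

Lemma exists_few_alive x : in_box x ->
  exists y, [/\ in_box y, (#|alive y| <= #|I|)%N &
    forall i, dot (a i) y = dot (a i) x].
Proof.
have [k] := ubnP #|alive x|; elim: k x => // k IH x xk xb.
have [xI|Ix] := leqP #|alive x| #|I|; first by exists x.
pose cs := [seq (fun h => (h == g)%:R : R) | g <- enum (~: alive x)] ++
  [seq a i | i <- enum I].
have Gx : (#|alive x| + #|~: alive x| = #|G|)%N by rewrite cardsC.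
have [|u [[g0 ug0]]] := @exists_orthogonal R G cs.
  by rewrite size_cat !size_map -enumT -!cardE -Gx addnC ltn_add2r.
rewrite /cs /orthogonal_to all_cat !all_map => /andP[/allP ud /allP ua].
have u0 g : g \notin alive x -> u g = 0.
  move=> gx; apply/eqP; rewrite -(dot_indicator g u); apply: ud.
  by rewrite mem_enum inE.
(* A full step of this length would move coordinate [g0] by 2, more than the width of the cube, so
   some coordinate must freeze first. *)
have d0 : 0 < 2 / `|u g0| by rewrite divr_gt0 // normr_gt0.
have [t [/andP[t0 _] yb _ yd]] := move_in_box d0 xb u0.
have {yd} yd : (#|alive (move x u t)| < #|alive x|)%N.
  case: yd => // tE; have := yb g0; have := xb g0; rewrite /move.
  have : `|t * u g0| = 2.
    by rewrite tE normrM ger0_norm ?ltW // divfK // normr_eq0.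
  clear Gx; move=> nE /andP[? ?] /andP[? ?].
  have [h|h] := ger0P (t * u g0).
    by rewrite ger0_norm // in nE; lra.
  by rewrite ltr0_norm // in nE; lra.
have [|y [yb' yI yx]] := IH (move x u t) _ yb; first by lia.
exists y; split=> // i; rewrite yx dot_mover.
have /eqP -> : dot (a i) u == 0 by apply: ua; have := mem_enum I i; rewrite enumT.
by rewrite mulr0 addr0.
Qed.

Lemma round_down y : in_box y -> exists z, [/\ in_box z, alive z = set0 &
  forall i, dot (a i) z <= dot (a i) y + #|alive y|%:R].
Proof.
move=> yb; exists (fun g => if g \in alive y then 0 else y g); split.
- by move=> g; case: ifP => // _; rewrite lexx ler01.
- apply/setP => g; rewrite [RHS]inE [LHS]inE; case: ifPn => [|gy].
    by rewrite eqxx.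
  by rewrite inE in gy; exact/negbTE.
move=> i; rewrite -sum1_card natr_sum [X in _ + X]big_mkcond /=.
rewrite -big_split /=; apply: ler_sum => g _.
case: ifP => _; last by rewrite addr0.
have /andP[y0 y1] := yb g; have := a_le1 i g; rewrite ler_norml => /andP[? ?].
nra.
Qed.

Variable m : nat.
Hypothesis Im : (#|I| <= m)%N.

Definition root4 (n : nat) : R := Num.sqrt (Num.sqrt (n%:R * m%:R)).

Lemma root4_pow n : root4 n ^+ 4 = n%:R * m%:R.
Proof. by rewrite -[4%N]/(2 * 2)%N exprM !sqr_sqrtr ?sqrtr_ge0 ?mulr_ge0. Qed.

Lemma root4_ge0 n : 0 <= root4 n.
Proof. exact: sqrtr_ge0. Qed.

Lemma exists_partial_rounding n x : (256 <= n <= m)%N -> in_box x ->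
  (#|alive x| <= n)%N ->
  exists y, [/\ in_box y, (16 * #|alive y| <= n)%N &
    forall i, dot (a i) y <= dot (a i) x + 28 * root4 n].
Proof.
move=> nm xb xn; have /andP[n256 nm'] := nm.
have n0 : 0 < n%:R :> R by rewrite ltr0n; lia.
have m0 : 0 < m%:R :> R by rewrite ltr0n; lia.
set h := root4 n.
have h4 : h ^+ 4 = n%:R * m%:R := root4_pow n.
have h0 : 0 < h.
  rewrite lt_neqAle root4_ge0 andbT; apply: contraTneq (mulr_gt0 n0 m0) => hE.
  by rewrite -h4 -hE expr0n ltxx.
(* [lam] balances the two terms of [ln (m / n) / lam + lam * n], after bounding
   the logarithm by a square root. *)
have lam0 : 0 < h / n%:R by rewrite divr_gt0.
have [y [yb yn wy]] := exists_phase a_le1 lam0 nm xn Im xb.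
exists y; split=> // i; have {wy} := wy i.
set lam := h / n%:R in lam0 *; set d := dot (a i) y - dot (a i) x => wd.
suff : d <= 28 * h by rewrite /d; lra.
(* [Q] is the square root of [m / n]; dividing the phase bound by [n] leaves only [Q]. *)
pose Q := lam * h.
have Q0 : 0 < Q by rewrite mulr_gt0.
have lamQ : lam ^+ 2 * n%:R = Q by rewrite /Q /lam; field; exact: lt0r_neq0.
have mQ : m%:R = Q ^+ 2 * n%:R.
  apply: (mulfI (lt0r_neq0 n0)); rewrite -h4 /Q /lam; field; exact: lt0r_neq0.
rewrite -(ler_pM2l lam0).
have -> : lam * (28 * h) = 28 * Q by rewrite /Q; ring.
have [|sQ] := leP (lam * d) (4 * Q); first by move=> ?; lra.
have s0 : 0 <= lam * d - 4 * Q by lra.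
have : expR (lam * d - 4 * Q) <= 128 * Q ^+ 2.
  rewrite exp.expRB ler_pdivrMr ?exp.expR_gt0 // -(ler_pM2l n0).
  apply: le_trans wd _; rewrite mQ -[4 * _ * _]mulrA lamQ le_eqVlt.
  by apply/orP; left; apply/eqP; ring.
move=> /(le_trans (expR_ge_sqr s0)) sq.
(* An excess above [24 * Q] would give [(1 + 12 * Q) ^+ 2 > 128 * Q ^+ 2]; the constant is 28 = 4 +
   24. *)
rewrite leNgt; apply/negP => big; nra.
Qed.

(** Dividing [n] by 16 halves [root4 n], so the phase errors form a geometric series with sum at
    most twice the first, 56 = 2 * 28. The 256 pays for rounding the last coordinates down. *)
Lemma exists_rounding_alive n x : (n <= m)%N -> in_box x -> (#|alive x| <= n)%N ->
  exists z, [/\ in_box z, alive z = set0 &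
    forall i, dot (a i) z <= dot (a i) x + 56 * root4 n + 256].
Proof.
elim/ltn_ind: n x => n IH x nm xb xn.
have [n256|n256] := ltnP n 256.
  have [z [zb za zx]] := round_down xb; exists z; split=> // i.
  apply: le_trans (zx i) _; rewrite -addrA lerD2l.
  have : #|alive x|%:R <= 256 :> R by rewrite ler_nat; lia.
  by have := root4_ge0 n; lra.
have [|y [yb yn yx]] := exists_partial_rounding _ xb xn; first by rewrite n256.
have [|||z [zb za zy]] := IH (n %/ 16)%N _ y _ yb.
- by lia.
- by lia.
- by rewrite leq_divRL // mulnC.
exists z; split=> // i; apply: le_trans (zy i) _.
suff : 2 * root4 (n %/ 16) <= root4 n by have := yx i; lra.
rewrite -(@ler_pXn2r _ 4) ?nnegrE ?mulr_ge0 ?root4_ge0 // exprMn !root4_pow.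
rewrite mulrA ler_wpM2r // -natrX -natrM ler_nat; lia.
Qed.

Lemma exists_rounding x : (0 < m)%N -> in_box x ->
  exists S : {set G}, forall i,
    \sum_(g in S) a i g <= dot (a i) x + 312 * Num.sqrt m%:R.
Proof.
move=> m0 xb; have [y [yb yI yx]] := exists_few_alive xb.
have [z [zb za zy]] := exists_rounding_alive (leqnn m) yb (leq_trans yI Im).
exists [set g | z g == 1] => i.
have -> : \sum_(g in [set g | z g == 1]) a i g = dot (a i) z.
  rewrite big_mkcond /=; apply: eq_bigr => g _; rewrite inE.
  have : g \notin alive z by rewrite za inE.
  rewrite inE negb_and !negbK => /orP[/eqP ->|/eqP ->].
    by rewrite eq_sym oner_eq0 mulr0.
  by rewrite eqxx mulr1.
(* [root4 m] is the square root of [m], which is at least 1, so 312 = 56 + 256 suffices. *)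
apply: le_trans (zy i) _; rewrite yx -addrA lerD2l /root4.
rewrite -expr2 sqrtr_sqr ger0_norm //.
have : 1 <= Num.sqrt m%:R :> R by rewrite -[leLHS]sqrtr1 ler_sqrt // ler1n.
lra.
Qed.

End Rounding.

(** * Recursive splitting of the groups *)

(** Makes the losses telescope over the recursion. The ratio [l / k] stays between 1/3 and 2/3, as
    halving with integer parts ensures for [k >= 2]. *)
Lemma split_loss (R : realType) (k l : nat) :
  (0 < l)%N -> (k <= 3 * l)%N -> (3 * l <= 2 * k)%N ->
  Num.sqrt k%:R / l%:R <= 12 * ((Num.sqrt l%:R)^-1 - (Num.sqrt k%:R)^-1) :> R.
Proof.
move=> l0 kl lk; have k0 : (0 < k)%N by lia.
set s := Num.sqrt k%:R; set r := Num.sqrt l%:R.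
have s0 : 0 < s :> R by rewrite sqrtr_gt0 ltr0n.
have r0 : 0 < r :> R by rewrite sqrtr_gt0 ltr0n.
have r2 : r ^+ 2 = l%:R :> R by rewrite sqr_sqrtr.
have s2 : s ^+ 2 = k%:R :> R by rewrite sqr_sqrtr.
have h1 : s ^+ 2 <= 3 * r ^+ 2 :> R by rewrite r2 s2 -natrM ler_nat.
have h2 : 3 * r ^+ 2 <= 2 * s ^+ 2 :> R by rewrite r2 s2 -!natrM ler_nat.
(* Rational bounds in place of the square roots of 1/3 and 2/3; on this range [12 * (r * (s - r))]
   is at least [s ^+ 2]. *)
have rs : s / 2 <= r by rewrite leNgt; apply/negP => ?; nra.
have sr : r <= 5 * s / 6 by rewrite leNgt; apply/negP => ?; nra.
rewrite -r2 -subr_ge0.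
have -> : 12 * (r^-1 - s^-1) - s / r ^+ 2
  = (12 * (r * (s - r)) - s ^+ 2) / (s * r ^+ 2).
  by field; rewrite !lt0r_neq0.
by rewrite divr_ge0 ?mulr_ge0 ?sqr_ge0 ?(ltW s0) //; nra.
Qed.

Section Groups.
Variables (R : realType) (G J : finType) (grp : J -> nat) (a : J -> G -> R).
Variable n : nat.
Hypothesis a_bounds : forall j g, 0 <= a j g <= 1.
Hypothesis n_gt0 : (0 < n)%N.
Hypothesis card_grp : forall lo k,
  (#|[pred j | (lo <= grp j < lo + k)%N]| <= k * n)%N.

(** The telescoped sum of the losses from [k] groups down to one: 3744 = 312 * 12, zero at [k = 1]
    and bounded uniformly in [k]. *)
Definition group_error (k : nat) : R :=
  3744 * Num.sqrt n%:R * (1 - (Num.sqrt k%:R)^-1).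

(** [A], [X] and [Y] stand for an agent's value of all goods, of the goods given to its half, and of
    its group's bundle. Divided by [l], the rounding error is the loss of [split_loss]. *)
Lemma group_error_step (k l : nat) (A X Y : R) :
  (0 < l)%N -> (k <= 3 * l)%N -> (3 * l <= 2 * k)%N ->
  l%:R / k%:R * A - 312 * Num.sqrt (k * n)%:R <= X ->
  X / l%:R - group_error l <= Y ->
  A / k%:R - group_error k <= Y.
Proof.
move=> l0 kl lk hX; apply: le_trans.
have loss := split_loss R l0 kl lk.
have l0' : 0 < l%:R :> R by rewrite ltr0n.
have k0' : 0 < k%:R :> R by rewrite ltr0n; lia.
have : (l%:R / k%:R * A - 312 * Num.sqrt (k * n)%:R) / l%:R <= X / l%:R.
  by rewrite ler_pM2r // invr_gt0.
have -> : (l%:R / k%:R * A - 312 * Num.sqrt (k * n)%:R) / l%:R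
   = A / k%:R - 312 * Num.sqrt n%:R * (Num.sqrt k%:R / l%:R).
  by rewrite natrM sqrtrM //; field; rewrite !lt0r_neq0.
have : 312 * Num.sqrt n%:R * (Num.sqrt k%:R / l%:R)
  <= 312 * Num.sqrt n%:R * (12 * ((Num.sqrt l%:R)^-1 - (Num.sqrt k%:R)^-1)) :> R.
  by rewrite ler_wpM2l // mulr_ge0 // sqrtr_ge0.
rewrite /group_error; lra.
Qed.

Lemma exists_group_assignment k lo (S : {set G}) : (0 < k)%N ->
  exists f : G -> nat, (forall g, lo <= f g < lo + k)%N /\
    forall j, (lo <= grp j < lo + k)%N ->
      (\sum_(g in S) a j g) / k%:R - group_error k
        <= \sum_(g in S | f g == grp j) a j g.
Proof.
elim/ltn_ind: k lo S => k IH lo S k0.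
have [k1|k2] := leqP k 1.
  have -> : k = 1%N by lia.
  exists (fun=> lo); split=> [g|j lj]; first by lia.
  rewrite /group_error sqrtr1 invr1 subrr mulr0 subr0 mulr1.
  have -> : grp j = lo by lia.
  by under [leRHS]eq_bigl do rewrite eqxx andbT.
pose k1 := k./2; pose k2' := (k - k1)%N.
pose I := {j : J | (lo <= grp j < lo + k)%N}.
(* Rounding bounds rows only from above. Negated rows give the first half a lower bound on
   [S :&: T]; for the second half an upper bound on [S :&: T] is a lower bound on [S :\: T]. *)
pose b (i : I) g := if g \in S then
  if (grp (val i) < lo + k1)%N then - a (val i) g else a (val i) g else 0.
have b_le1 i g : `|b i g| <= 1.
  rewrite /b; have /andP[a0 a1] := a_bounds (val i) g.
  by do 2?case: ifP => _; rewrite ?normrN ?normr0 // ger0_norm.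
have cI : (#|{: I}| <= k * n)%N by rewrite card_sig card_grp.
have kn0 : (0 < k * n)%N by rewrite muln_gt0 k0.
have k0R : 0 < k%:R :> R by rewrite ltr0n.
pose p : R := k1%:R / k%:R.
have pb : in_box (fun _ : G => p).
  move=> g; rewrite /p divr_ge0 //= ler_pdivrMr // mul1r ler_nat /k1; lia.
have [T hT] := exists_rounding b_le1 cI kn0 pb.
have [||f1 [f1b f1s]] := IH k1 _ lo (S :&: T); [by lia|by lia|].
have [||f2 [f2b f2s]] := IH k2' _ (lo + k1)%N (S :\: T); [by lia|by lia|].
exists (fun g => if g \in T then f1 g else f2 g); split=> [g|j jlo].
  by case: ifP => _; [have := f1b g|have := f2b g]; rewrite /k2' /k1; lia.
have := hT (exist _ j jlo).
have -> : dot (b (exist _ j jlo)) (fun=> p)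
  = (if (grp j < lo + k1)%N then - p else p) * \sum_(g in S) a j g.
  rewrite /dot mulr_sumr [RHS]big_mkcond; apply: eq_bigr => g _; rewrite /b /=.
  by case: (g \in S); case: (grp j < lo + k1)%N => /=; ring.
have -> : \sum_(g in T) b (exist _ j jlo) g
  = (if (grp j < lo + k1)%N then - 1 else 1) * \sum_(g in S :&: T) a j g.
  rewrite mulr_sumr [LHS]big_mkcond [RHS]big_mkcond; apply: eq_bigr => g _.
  rewrite inE /b /= andbC.
  by case: (g \in T); case: (g \in S); case: (grp j < lo + k1)%N => /=; ring.
have [jl|jl] := ltnP (grp j) (lo + k1) => hS.
  apply: (@group_error_step _ k1 _ (\sum_(g in S :&: T) a j g)); rewrite /k1; try lia.
    by rewrite -/k1 -/p; lra.
  have := f1s j; rewrite jl andbT; case/andP: jlo => -> _ /(_ isT) h.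
  apply: le_trans h _; rewrite le_eqVlt; apply/orP; left; apply/eqP.
  apply: eq_bigl => g; rewrite inE; case: ifP => gT; rewrite ?andbT ?andbF //=.
  (* [f2] only takes values from [lo + k1] on, so goods outside [T] never reach a group of the first
     half. *)
  have := f2b g; case: eqP => [->|]; rewrite ?andbF //; lia.
have SD : \sum_(g in S) a j g = \sum_(g in S :&: T) a j g + \sum_(g in S :\: T) a j g.
  by rewrite -big_setID.
apply: (@group_error_step _ k2' _ (\sum_(g in S :\: T) a j g)); rewrite /k2' /k1; try lia.
  rewrite natrB; last by lia.
  rewrite mulrBl divff ?lt0r_neq0 // -/k1 -/p; lra.
have h : (lo + k1 <= grp j < lo + k1 + k2')%N by rewrite /k2' /k1; lia.
apply: le_trans (f2s j h) _; rewrite le_eqVlt; apply/orP; left; apply/eqP.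
apply: eq_bigl => g; rewrite inE; case: ifP => gT; rewrite ?andbT ?andbF //=.
have := f1b g; case: eqP => [->|]; rewrite ?andbF //; lia.
Qed.

End Groups.

(** * From value shares to PROP allocations *)

(** Greedy choice: each new good is the best one left, and its value becomes [w], which never
    increases. If no good is left, [w] is 0. *)
Lemma exists_top_set (R : realType) (G : finType) (v : G -> R) (c : nat) :
  (forall g, 0 <= v g) ->
  exists T : {set G}, exists w : R, [/\ (#|T| <= c)%N, 0 <= w,
    forall g, g \notin T -> v g <= w & c%:R * w <= \sum_(g in T) v g].
Proof.
move=> v0; elim: c => [|c [T [w [Tc w0 Tw cw]]]].
  exists set0, (\sum_g v g); split; rewrite ?cards0 ?sumr_ge0 //.
    by move=> g _; rewrite (bigD1 g) //= lerDl sumr_ge0.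
  by rewrite mul0r big_set0.
have [g0 g0T|T0] := pickP [pred g | g \notin T]; last first.
  exists T, 0; split; rewrite ?mulr0 ?sumr_ge0 //; first exact: leqW.
  by move=> g gT; have := T0 g; rewrite /= gT.
have [g1 g1T max1] := @arg_maxP _ R G g0 [pred g | g \notin T] v g0T.
rewrite inE in g1T.
exists (g1 |: T), (v g1); split=> //.
- by rewrite cardsU1 g1T add1n.
- by move=> g; rewrite !inE negb_or => /andP[_ gT]; apply: max1.
rewrite big_setU1 //= -natr1 [leLHS]mulrDl mul1r [leLHS]addrC lerD2l.
by apply: le_trans cw; rewrite ler_wpM2l // Tw.
Qed.

Lemma card_tag_interval (k : nat) (n : 'I_k -> nat) (N lo l : nat) :
  (forall i, n i <= N)%N ->
  (#|[pred j : {i : 'I_k & 'I_(n i)} | lo <= tag j < lo + l]| <= l * N)%N.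
Proof.
move=> nN; rewrite -sum1_card.
rewrite (eq_bigl (fun j : {i : 'I_k & 'I_(n i)} => (lo <= tag j < lo + l) && true)%N);
  last by move=> j; rewrite andbT.
rewrite -(sig_big_dep (fun i : 'I_k => lo <= i < lo + l)%N
  (fun i (j : 'I_(n i)) => true) (fun _ _ => 1%N)) /=.
apply: (@leq_trans (\sum_(i < k | lo <= i < lo + l) N)%N).
  by apply: leq_sum => i _; rewrite sum1_card card_ord.
rewrite sum_nat_const leq_mul2r; apply/orP; right.
rewrite cardE -(size_map val) -[leqRHS](size_iota lo); apply: uniq_leq_size.
  by rewrite map_inj_uniq ?enum_uniq //; apply: val_inj.
by move=> i /mapP[i' + ->]; rewrite mem_enum mem_iota; apply.
Qed.

Lemma PROP_guaranteed_large (R : realType) (k : nat) (n : 'I_k -> nat) (N c : nat) :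
  (2 <= k)%N -> (0 < N)%N -> (forall i, n i <= N)%N ->
  7488 * Num.sqrt N%:R <= c%:R :> R -> PROP_guaranteed R n c.
Proof.
move=> k2 N0 nN cN G u ma.
pose J := {i : 'I_k & 'I_(n i)}.
pose v (j : J) g := u (tag j) (tagged j) [set g].
have v0 j g : 0 <= v j g := (ma (tag j) (tagged j)).2 g.
have uE (j : J) S : u (tag j) (tagged j) S = \sum_(g in S) v j g.
  exact: (ma (tag j) (tagged j)).1.
have [T hT] := boolp.choice (fun j => exists_top_set c (v0 j)).
have {hT} [w hw] := boolp.choice hT.
pose a (j : J) g := if g \in T j then 0 else v j g / w j.
have aw j g : g \notin T j -> v j g = w j * a j g.
  have [_ w0 Tw _] := hw j; rewrite /a => gT; rewrite (negPf gT).
  (* If [w j] is 0, all goods outside [T j] are worthless, so the division by zero does no harm. *)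
  have := w0; rewrite le_eqVlt => /orP[/eqP wE|wp].
    by rewrite -wE mul0r; apply/eqP; rewrite eq_le v0 andbT wE Tw.
  by rewrite mulrC divfK // lt0r_neq0.
have a01 j g : 0 <= a j g <= 1.
  have [_ w0 Tw _] := hw j; rewrite /a; case: ifPn => gT; first by rewrite lexx ler01.
  rewrite divr_ge0 //=; have := w0; rewrite le_eqVlt => /orP[/eqP <-|wp].
    by rewrite invr0 mulr0 ler01.
  by rewrite ler_pdivrMr // mul1r Tw.
have [|f [fk hf]] := exists_group_assignment a01 N0
    (fun lo l => @card_tag_interval k n N lo l nN) 0 [set: G] (k := k).
  by lia.
pose A (i : 'I_k) := [set g | f g == i].
exists A; split; first split.
- move=> i i' ii'; rewrite disjoint_subset; apply/subsetP => g.
  by rewrite !inE => /eqP ->.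
- apply/setP => g; rewrite inE; apply/bigcupP.
  by have /andP[_ gk] := fk g; exists (Ordinal gk); rewrite ?inE.
move=> i j; pose t : J := existT _ i j.
have [Tc w0 Tw cw] := hw t.
exists (T t :\: A i); split.
- by apply: setSD; apply: subsetT.
- by apply: leq_trans Tc; apply: subset_leq_card; apply: subsetDl.
rewrite !(uE t).
have := hf t (ltn_ord i).
have -> : \sum_(g in [set: G] | f g == tag t) a t g = \sum_(g in A i) a t g.
  by apply: eq_bigl => g; rewrite !inE.
set XA := \sum_(g in A i) a t g; set X := \sum_(g in [set: G]) a t g => hX.
set V := \sum_(g in T t) v t g in cw.
have aT (S : {set G}) : \sum_(g in S) v t g
    = \sum_(g in S :&: T t) v t g + w t * \sum_(g in S) a t g.
  rewrite (big_setID (T t)) /=; congr (_ + _).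
  rewrite mulr_sumr [RHS](big_setID (T t)) /= [X in _ = X + _]big1 ?add0r.
    by apply: eq_bigr => g; rewrite inE => /andP[/aw].
  by move=> g; rewrite inE /a => /andP[_ ->]; rewrite mulr0.
rewrite (aT (A i)) (aT setT) setTI -/XA -/X -/V.
have : V = \sum_(g in A i :&: T t) v t g + \sum_(g in T t :\: A i) v t g.
  by rewrite /V (big_setID (A i)) /= setIC.
set P := \sum_(g in _ :&: _) _; set Q := \sum_(g in _ :\: _) _ => VPQ.
have V0 : 0 <= V by apply: sumr_ge0 => g _; apply: v0.
have k0 : 0 < k%:R :> R by rewrite ltr0n; lia.
(* [A i] and the repair set together keep all of [V]. Half of it covers the share [V / k], as
   [k >= 2]; the other half covers the group error, since [c * w <= V]. *)
have Vk : V / k%:R <= V / 2.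
  by rewrite ler_wpM2l // lef_pV2 ?posrE // ler_nat.
(* This is at most [c / 2], which is why 7488 = 2 * 3744. *)
have err : group_error R N k <= 3744 * Num.sqrt N%:R.
  rewrite /group_error -[leRHS]mulr1 ler_wpM2l ?mulr_ge0 ?sqrtr_ge0 //.
  by rewrite lerBlDr lerDl invr_ge0 sqrtr_ge0.
have : w t * (X / k%:R - c%:R / 2) <= w t * XA.
  by rewrite ler_wpM2l //; lra.
have -> : (V + w t * X) / k%:R = V / k%:R + w t * (X / k%:R).
  by rewrite mulrDl mulrA.
rewrite mulrBr; lra.
Qed.

Theorem corollary5p1 (R : realType) :
  exists C : R, 0 < C /\
    forall (k : nat) (hk : (2 <= k)%N) (n : 'I_k -> nat),
      (forall i : 'I_k, (0 < n i)%N) ->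
      (forall i i' : 'I_k, (i <= i')%N -> (n i' <= n i)%N) ->
      exists c : nat,
        is_cPROP R n c /\
        c%:R <= C * Num.sqrt (n (Ordinal (ltnW hk)))%:R.
Proof.
(* The extra 1 absorbs rounding [7488 * Num.sqrt N%:R] up to an integer, as the square root is at
   least 1. *)
exists 7489; split=> // k hk n n0 nmono.
set N := n (Ordinal (ltnW hk)).
have nN i : (n i <= N)%N by apply: nmono.
have sN : 1 <= Num.sqrt N%:R :> R.
  by rewrite -[leLHS]sqrtr1 ler_sqrt // ler1n n0.
have D0 : 0 <= 7488 * Num.sqrt N%:R :> R by rewrite mulr_ge0 // sqrtr_ge0.
have /andP[tr1 tr2] := Num.Theory.truncn_itv D0.
set b := (Num.truncn _).+1 in tr2.
have Pb : PROP_guaranteed R n b.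
  exact: PROP_guaranteed_large (n0 _) nN (ltW tr2).
have ex : exists c, boolp.asbool (PROP_guaranteed R n c).
  by exists b; apply/boolp.asboolP.
exists (ex_minn ex); case: ex_minnP => c /boolp.asboolP Pc minc; split.
  by split=> // c' /boolp.asboolP; apply: minc.
apply: (@le_trans _ _ b%:R); first by rewrite ler_nat minc //; apply/boolp.asboolP.
rewrite /b -natr1; lra.
Qed.
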